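(* For the generic $h \in \mathcal{H}(\{0,1\}^{\mathbb{N}})$, the induced map $\widetilde{h} : \mathcal{M}(\{0,1\}^{\mathbb{N}}) \to \mathcal{M}(\{0,1\}^{\mathbb{N}})$ has no Li-Yorke pair. That is, the set of all $h \in \mathcal{H}(\{0,1\}^{\mathbb{N}})$ for which $\widetilde{h}$ has a Li-Yorke pair is of the first category in $\mathcal{H}(\{0,1\}^{\mathbb{N}})$.
   Context: The Cantor space $\{0,1\}^{\mathbb{N}}$ ($\mathbb{N}=\{1,2,\dots\}$) carries the metric $d(\sigma,\sigma)=0$ and $d(\sigma,\tau)=1/n$, where $n$ is the least positive integer with $\sigma(n)\ne\tau(n)$. $\mathcal{H}(\{0,1\}^{\mathbb{N}})$ is the space of all homeomorphisms of $\{0,1\}^{\mathbb{N}}$ onto itself with the metric $\tilde d(f,g)=\max_x d(f(x),g(x))$; it is a Baire space. ''The generic element of a Baire space $Z$ has property $P$'' means that the set of elements of $Z$ failing $P$ is of the first category (meager) in $Z$. For a compact metric space $(M,d)$, $\mathcal{M}(M)$ is the space of Borel probability measures on $M$ with the Prohorov metric $d_P(\mu,\nu)=\inf\{\delta>0:\mu(X)\le\nu(X^\delta)+\delta \text{ and } \nu(X)\le\mu(X^\delta)+\delta \text{ for all Borel } X\subset M\}$, where $X^\delta=\{x\in M: d(x,X)<\delta\}$; it is a compact metric space. For a continuous map $f:M\to M$, the induced map $\widetilde f:\mathcal{M}(M)\to\mathcal{M}(M)$ is $(\widetilde f(\mu))(X)=\mu(f^{-1}(X))$ for Borel $X$. For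 a continuous self-map $g$ of a compact metric space with metric $\rho$, a pair $(x,y)$ is a Li-Yorke pair for $g$ if $\liminf_{n\to\infty}\rho(g^n(x),g^n(y))=0$ and $\limsup_{n\to\infty}\rho(g^n(x),g^n(y))>0$. *)

(* Defs.v *)
From HB Require Import structures.
From mathcomp Require Import all_boot all_order all_algebra.
From mathcomp Require Import finmap.
From mathcomp Require Import all_classical all_reals all_analysis.

Set Implicit Arguments.
Unset Strict Implicit.
Unset Printing Implicit Defensive.

Import Order.TTheory GRing.Theory Num.Theory.

Local Open Scope classical_set_scope.
Local Open Scope ring_scope.

Section Category.
Context {T : topologicalType}.

Definition nowhere_dense (A : set T) := interior (closure A) = set0.

Definition meager (A : set T) :=
  exists2 F : (set T)^nat, (forall n, nowhere_dense (F n)) & A = \bigcup_n F n.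

End Category.

(* Li-Yorke pairs of g for the distance rho; the limits are taken in \bar R so
   that no boundedness side condition is needed. *)
Section LiYorke.
Context {R : realType} {T : Type}.
Local Open Scope ereal_scope.

Definition li_yorke_pair (rho : T -> T -> R) (g : T -> T) (x y : T) :=
  limn_einf (fun n => (rho (iter n g x) (iter n g y))%:E) = 0 /\
  0 < limn_esup (fun n => (rho (iter n g x) (iter n g y))%:E).

Definition has_li_yorke_pair (rho : T -> T -> R) (g : T -> T) :=
  exists x y, li_yorke_pair rho g x y.

End LiYorke.

#[short(type="pmetricType")]
HB.structure Definition PointedMetric (R : numDomainType) :=
  {M of Pointed M & Metric R M}.

Notation borel M := (g_sigma_algebraType (@open M)).

(* Two members of this type may differ on non-Borel sets, where the library
   leaves measures unconstrained.  The notions below only look at Borel sets. *)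
Definition borel_prob {R : realType} (M : pmetricType R) :=
  probability (borel M) R.

Section Prohorov.
Context {R : realType} {M : pmetricType R}.
Local Open Scope ereal_scope.

(* The infimum is taken in \bar R: the distance to the empty set is +oo. *)
Definition dist_to_set (x : M) (X : set M) : \bar R :=
  ereal_inf [set (mdist x y)%:E | y in X].

Definition thickening (X : set M) (delta : R) : set M :=
  [set x | dist_to_set x X < delta%:E].

Definition prohorov_dist (mu nu : borel_prob M) : R :=
  inf [set delta : R | (0 < delta)%R /\
    forall X : set (borel M), measurable X ->
      mu X <= nu (thickening X delta) + delta%:E /\
      nu X <= mu (thickening X delta) + delta%:E].

End Prohorov.

Section Induced.
Context {R : realType} {M : pmetricType R}.

Definition borel_fun (f : continuousType M M) : borel M -> borel M := f.

Lemma measurable_borel_fun (f : continuousType M M) :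
  measurable_fun [set: borel M] (borel_fun f).
Proof.
apply: (@measurability _ _ (borel M) (borel M) setT _ (@open M)) => //.
move=> _ [B oB <-]; rewrite setTI; apply: sub_sigma_algebra.
by apply: open_comp => // x _; exact: cts_fun.
Qed.

HB.instance Definition _ (f : continuousType M M) :=
  isMeasurableFun.Build _ _ (borel M) (borel M) (borel_fun f)
    (measurable_borel_fun f).

(* [distribution mu g] is the pushforward X |-> mu (g @^-1` X). *)
Definition induced_map (f : continuousType M M) (mu : borel_prob M) : borel_prob M :=
  distribution mu (borel_fun f).

End Induced.

(* Index i : nat stands for the coordinate i.+1 of the sequence. *)
Section CantorMetric.
Context (R : realType).
Implicit Types (s t u : cantor_space) (n : nat).

Definition cantor_dist s t : R :=
  if pselect (exists n, s n != t n) is left st then (ex_minn st).+1%:R^-1 else 0.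

Lemma cantor_dist_ltP s t n :
  cantor_dist s t < n.+1%:R^-1 <-> forall i, (i <= n)%N -> s i = t i.
Proof.
rewrite /cantor_dist; case: pselect => [st|st]; last first.
  split=> [_ i _|_]; last by rewrite invr_gt0.
  by apply: contrapT => /eqP sti; apply: st; exists i.
case: ex_minnP => m stm mmin.
rewrite ltf_pV2 ?posrE// ltr_nat ltnS; split=> [nm i im|H].
  apply: contrapT => /eqP /mmin mi.
  by have := leq_ltn_trans (leq_trans mi im) nm; rewrite ltnn.
by rewrite ltnNge; apply/negP => /H/eqP; rewrite (negbTE stm).
Qed.

Lemma cantor_distxx s : cantor_dist s s = 0.
Proof.
rewrite /cantor_dist; case: pselect => // st; exfalso.
by case: st => n; rewrite eqxx.
Qed.

Lemma cantor_dist_ge0 s t : 0 <= cantor_dist s t.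
Proof. by rewrite /cantor_dist; case: pselect => // st; rewrite invr_ge0. Qed.

Lemma cantor_dist_le1 s t : cantor_dist s t <= 1.
Proof.
rewrite /cantor_dist; case: pselect => // st.
by rewrite invf_le1// ler1n.
Qed.

Lemma cantor_dist_positivity s t : cantor_dist s t = 0 -> s = t.
Proof.
move=> st0; apply/funext => n.
by apply: ((cantor_dist_ltP s t n).1 _ n (leqnn n)); rewrite st0 invr_gt0.
Qed.

Lemma cantor_dist_values s t :
  cantor_dist s t = 0 \/ exists n, cantor_dist s t = n.+1%:R^-1.
Proof.
by rewrite /cantor_dist; case: pselect => [st|_]; [right; eexists|left].
Qed.

Lemma cantor_dist_sym s t : cantor_dist s t = cantor_dist t s.
Proof.
rewrite /cantor_dist; case: pselect => [st|st]; case: pselect => [ts|ts] //.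
- case: ex_minnP => m stm mmin; case: ex_minnP => k tsk kmin.
  congr (_.+1%:R^-1); apply/eqP; rewrite eqn_leq.
  by rewrite mmin 1?eq_sym// kmin// eq_sym.
- by exfalso; apply: ts; case: st => n; rewrite eq_sym; exists n.
- by exfalso; apply: st; case: ts => n; rewrite eq_sym; exists n.
Qed.

Lemma cantor_dist_ultra t s u :
  cantor_dist s u <= Num.max (cantor_dist s t) (cantor_dist t u).
Proof.
have [->|[n sun]] := cantor_dist_values s u.
  by rewrite le_max cantor_dist_ge0.
rewrite leNgt; apply/negP; rewrite sun gt_max => /andP[].
move=> /cantor_dist_ltP st /cantor_dist_ltP tu.
suff : cantor_dist s u < n.+1%:R^-1 by rewrite sun ltxx.
by apply/cantor_dist_ltP => i ni; rewrite st// tu.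
Qed.

Lemma cantor_dist_triangle t s u :
  cantor_dist s u <= cantor_dist s t + cantor_dist t u.
Proof.
rewrite (le_trans (cantor_dist_ultra t _ _))// ge_max.
by rewrite lerDl lerDr !cantor_dist_ge0.
Qed.

Let ball s (e : R) t := cantor_dist s t < e.

Let ball_center s (e : R) : 0 < e -> ball s e s.
Proof. by move=> e0; rewrite /ball cantor_distxx. Qed.

Let ball_sym s t (e : R) : ball s e t -> ball t e s.
Proof. by rewrite /ball cantor_dist_sym. Qed.

Let ball_triangle s t u (e1 e2 : R) :
  ball s e1 t -> ball t e2 u -> ball s (e1 + e2) u.
Proof.
rewrite /ball => st tu.
by rewrite (le_lt_trans (cantor_dist_triangle t _ _))// ltrD.
Qed.

Let entourage_coord n :
  @entourage cantor_space [set st : cantor_space * cantor_space | st.1 n = st.2 n].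
Proof.
pose E := [set st : cantor_space * cantor_space | st.1 n = st.2 n].
pose TS i := initial_topology (@proj nat (fun=> bool) i).
have entE : `[< @entourage (TS n) E >].
  apply/asboolP; exists diagonal => //; first by move=> _ [b _ <-].
exists E => //; exists [fset (exist _ ((n : {classic nat}), E) entE)]%fset.
  by move=> p _; exact: in_setT.
rewrite eqEsubset; split=> st.
  by move=> /(_ (exist _ ((n : {classic nat}), E) entE)); apply; rewrite /= inE.
by move=> Est p /=; rewrite inE => /eqP ->.
Qed.

Let entourageE : @entourage cantor_space = entourage_ ball.
Proof.
rewrite eqEsubset; split=> A.
  move=> [_ [F _ <-] FA].
  pose N := (\max_(p <- F) ((projT1 p).1 : nat))%N.
  exists N.+1%:R^-1 => //= -[s t] /cantor_dist_ltP st.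
  apply: FA => p pF; move: (st (projT1 p).1 (leq_bigmax_seq _ pF isT)).
  case: p {pF} => -[i E] /= /[dup] /asboolP[V entV VE] _ sti.
  by apply: VE; have := entourage_refl (s i) entV; rewrite {2}sti.
move=> [e /= e0 eA].
pose n := Num.truncn e^-1.
have ne : n.+1%:R^-1 <= e.
  by rewrite -[leRHS]invrK lef_pV2 ?posrE ?invr_gt0// ltW// truncnS_gt.
have entF : Filter (@entourage cantor_space) by exact: entourage_filter.
suff : @entourage cantor_space [set st | forall i, (i < n.+1)%N -> st.1 i = st.2 i].
  apply: filterS => -[s t] /= st; apply: eA; rewrite /ball/=.
  by apply: lt_le_trans ne; apply/cantor_dist_ltP.
elim: n.+1 => [|m IH]; first by apply: filterS filterT => st _ i.
apply: filterS (filterI IH (entourage_coord m)) => st [/= stm stE] i.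
by rewrite ltnS leq_eqVlt => /predU1P[->//|im]; exact: (stm i im).
Qed.

HB.instance Definition _ := @Uniform_isPseudoMetric.Build R cantor_space
  ball ball_center ball_sym ball_triangle entourageE.

Let ballEdist s (d : R) :
  pseudometric_structure.ball s d = [set t | cantor_dist s t < d].
Proof. by []. Qed.

HB.instance Definition _ := @PseudoMetric_isMetric.Build R cantor_space
  cantor_dist cantor_dist_ge0 cantor_dist_positivity ballEdist.

End CantorMetric.

Definition is_homeomorphism {X Y : topologicalType} (f : X -> Y) :=
  exists g : Y -> X, [/\ cancel f g, cancel g f, continuous f & continuous g].

(* The parameter R is the field of values of the metric put on this type. *)
Record cantor_homeo (R : realType) := CantorHomeo {
  homeo_fun :> cantor_space -> cantor_space;
  homeo_funP : is_homeomorphism homeo_fun }.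

Section CantorHomeo.
Context (R : realType).
Implicit Types f g h : cantor_homeo R.

HB.instance Definition _ := gen_eqMixin (cantor_homeo R).
HB.instance Definition _ := gen_choiceMixin (cantor_homeo R).

Lemma cantor_homeoP f g : f =1 g -> f = g.
Proof.
case: f g => f fP [g gP] /= /funext fg; case: _ / fg gP => gP.
by congr CantorHomeo; exact: Prop_irrelevance.
Qed.

Let cts_homeo h : continuous h.
Proof. by case: h => h [g []]. Qed.

HB.instance Definition _ h := isContinuous.Build _ _ (homeo_fun h) (@cts_homeo h).

Definition homeo_dist f g : R :=
  sup (range (fun x => mdist (f x) (g x))).

Lemma homeo_dist_ub f g x : cantor_dist R (f x) (g x) <= homeo_dist f g.
Proof.
apply: ub_le_sup; last by exists x.
by exists 1 => _ [y _ <-]; exact: cantor_dist_le1.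
Qed.

(* The supremum in [homeo_dist] is a maximum. *)
Lemma homeo_dist_max f g : exists x, homeo_dist f g = mdist (f x) (g x).
Proof.
suff [x xmax] : exists x, forall y,
    cantor_dist R (f y) (g y) <= cantor_dist R (f x) (g x).
  exists x; apply/eqP; rewrite eq_le homeo_dist_ub andbT.
  by apply: ge_sup => [|_ [y _ <-]]; [exists (mdist (f x) (g x)), x|exact: xmax].
pose P n := `[< exists x, cantor_dist R (f x) (g x) = n.+1%:R^-1 >].
have [exP|nP] := pselect (exists n, P n).
  case: (ex_minnP exP) => n /asboolP[x xn] nmin; exists x => y.
  have [->|[k yk]] := cantor_dist_values R (f y) (g y).
    exact: cantor_dist_ge0.
  rewrite xn yk lef_pV2 ?posrE// ler_nat ltnS; apply: nmin.
  by apply/asboolP; exists y.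
exists point => y; have [->|[k yk]] := cantor_dist_values R (f y) (g y).
  exact: cantor_dist_ge0.
by exfalso; apply: nP; exists k; apply/asboolP; exists y.
Qed.

Let homeo_distxx f : homeo_dist f f = 0.
Proof. by have [x ->] := homeo_dist_max f f; exact: cantor_distxx. Qed.

Let homeo_dist_positivity f g : homeo_dist f g = 0 -> f = g.
Proof.
move=> fg0; apply: cantor_homeoP => x; apply: (@cantor_dist_positivity R).
by apply/eqP; rewrite eq_le cantor_dist_ge0 andbT -fg0 homeo_dist_ub.
Qed.

Let homeo_dist_sym f g : homeo_dist f g = homeo_dist g f.
Proof.
rewrite /homeo_dist; congr (sup _).
by apply: eq_imagel => x _; exact: cantor_dist_sym.
Qed.

Let homeo_dist_triangle g f h :
  homeo_dist f h <= homeo_dist f g + homeo_dist g h.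
Proof.
have [x ->] := homeo_dist_max f h.
by rewrite (le_trans (cantor_dist_triangle _ (g x) _ _))// lerD// homeo_dist_ub.
Qed.

HB.instance Definition _ := @isMetric.Build R (cantor_homeo R) homeo_dist
  homeo_distxx homeo_dist_positivity homeo_dist_sym homeo_dist_triangle.

End CantorHomeo.

(* Main.v *)
(* Call h predictable at scale m when the Cantor space has a finite clopen
   colouring c with small cells and a map phi on colours such that every orbit
   satisfies c (h x) = phi (c x) at all but at most one time.  Predictability is
   open, since it only involves c \o h.  It is dense: the transitions of h
   between cylinders form a finite digraph with positive in- and out-degrees,
   through every vertex of which runs a walk that leaves a cycle and later
   follows a fixed successor map; a homeomorphism realising these walks moves
   points as h does, up to a small error.
   If h is predictable at scale m then, from some time n on, almost all the
   mass of h^n mu and h^n nu follows phi, so the masses of the cells at time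
   n + k are up to a small error images under phi^k of the masses at time n.
   Hence if the two measures are once close after time n, they remain close up
   to the mesh of the colouring, and liminf = 0 forces limsup = 0. *)
Require Import Defs.
From mathcomp Require Import all_boot all_order all_algebra.
From mathcomp Require Import lra.
From mathcomp Require Import all_classical all_reals all_analysis.

Set Implicit Arguments.
Unset Strict Implicit.
Unset Printing Implicit Defensive.

Import Order.TTheory GRing.Theory Num.Theory.

Local Open Scope classical_set_scope.

(** * Prefixes of binary sequences and continuity expressed through them *)

Definition agree n (x y : cantor_space) := forall i, (i < n)%N -> x i = y i.

Definition factors_through n T (c : cantor_space -> T) :=
  forall x y, agree n x y -> c x = c y.

(** A modulus of continuity on prefixes; by compactness this is plain continuity, see
    [uniformly_ctsP]. *)
Definition uniformly_cts (f : cantor_space -> cantor_space) :=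
  forall n, exists m, forall x y, agree m x y -> agree n (f x) (f y).

Lemma agree_trans n y x z : agree n x y -> agree n y z -> agree n x z.
Proof. by move=> xy yz i ni; rewrite xy// yz. Qed.

Lemma agree_sym n x y : agree n x y -> agree n y x.
Proof. by move=> xy i ni; rewrite xy. Qed.

Lemma agreeW m n x y : (m <= n)%N -> agree n x y -> agree m x y.
Proof. by move=> mn xy i im; apply: xy; exact: leq_trans im mn. Qed.

Definition ccons (b : bool) (x : cantor_space) : cantor_space :=
  fun n => if n is n'.+1 then x n' else b.

Definition ctail (x : cantor_space) : cantor_space := fun n => x n.+1.

Lemma ccons_tail x : ccons (x 0) (ctail x) = x.
Proof. by apply/funext => -[]. Qed.

Lemma agree_cons n b x y : agree n x y -> agree n.+1 (ccons b x) (ccons b y).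
Proof. by move=> xy [|i]//= ni; apply: xy. Qed.

Lemma agree_tail n x y : agree n.+1 x y -> agree n (ctail x) (ctail y).
Proof. by move=> xy i ni; apply: xy. Qed.

Lemma uniformly_cts_id : uniformly_cts id.
Proof. by move=> n; exists n. Qed.

Lemma uniformly_cts_comp f g :
  uniformly_cts f -> uniformly_cts g -> uniformly_cts (f \o g).
Proof.
move=> cf cg n; have [m fm] := cf n; have [p gp] := cg m.
by exists p => x y /gp /fm.
Qed.

Lemma uniformly_cts_cons b : uniformly_cts (ccons b).
Proof.
move=> n; exists n => x y xy; apply: (agreeW (leqnSn n)).
exact: agree_cons.
Qed.

Lemma uniformly_cts_tail : uniformly_cts ctail.
Proof. by move=> n; exists n.+1 => x y; exact: agree_tail. Qed.

(** As there are finitely many pieces, the maximum of their moduli and of [L] serves them all. *)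
Lemma uniformly_cts_piecewise L (E : finType) (c : cantor_space -> E)
    (k : E -> cantor_space -> cantor_space) : factors_through L c ->
  (forall e, uniformly_cts (k e)) -> uniformly_cts (fun x => k (c x) x).
Proof.
move=> cL kc n; have [m mP] := choice (fun e => kc e n).
exists (maxn L (\max_e m e)) => x y xy.
rewrite (cL x y); last by apply: agreeW xy; rewrite leq_maxl.
apply: mP; apply: agreeW xy.
by rewrite (leq_trans _ (leq_maxr _ _))//; apply: (leq_bigmax (c y)).
Qed.

(** * Clopen colourings and homeomorphisms between their classes *)

Lemma head_factors : factors_through 1 (fun x : cantor_space => x 0).
Proof. by move=> x y; apply. Qed.

(* Induction on L, splitting P according to the first coordinate; a half of P
   may be empty, and then the other half alone is the Cantor space. *)
Lemma clopen_cantor L (P : cantor_space -> bool) :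
  factors_through L P -> (exists x, P x) ->
  exists g k : cantor_space -> cantor_space,
    [/\ uniformly_cts g, uniformly_cts k, forall y, P (k y),
        cancel k g & forall x, P x -> k (g x) = x].
Proof.
elim: L P => [|L IH] P PL [x0 Px0].
  exists id, id; split=> //; try exact: uniformly_cts_id.
  by move=> y; rewrite (PL y x0).
pose Pb b x := P (ccons b x).
have PbL b : factors_through L (Pb b).
  by move=> x y xy; apply: PL; exact: agree_cons.
have neqb (a b : bool) : a != b -> a = ~~ b by case: a b => -[].
have [[b nPb]|Pboth] := pselect (exists b, ~ exists x, Pb b x).
  have Pnb : exists x, Pb (~~ b) x.
    exists (ctail x0); rewrite /Pb; case: (eqVneq (x0 0) b) => xb.
      by case: nPb; exists (ctail x0); rewrite /Pb -xb ccons_tail.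
    by rewrite -(neqb _ _ xb) ccons_tail.
  have [g [k [gc kc Pk kg gk]]] := IH _ (PbL _) Pnb.
  exists (g \o ctail), (ccons (~~ b) \o k); split=> //.
  - by apply: uniformly_cts_comp => //; exact: uniformly_cts_tail.
  - by apply: uniformly_cts_comp => //; exact: uniformly_cts_cons.
  - move=> x Px /=; have xb : x 0 = ~~ b.
      case: (eqVneq (x 0) b) => xb; last exact: neqb.
      by case: nPb; exists (ctail x); rewrite /Pb -xb ccons_tail.
    by rewrite gk /Pb -xb ccons_tail.
have Pex b : exists x, Pb b x.
  by apply: contrapT => nP; apply: Pboth; exists b.
have [g gP] := choice (fun b => IH _ (PbL b) (Pex b)).
have [k kP] := choice gP.
exists (fun x => ccons (x 0) (g (x 0) (ctail x))),
       (fun x => ccons (x 0) (k (x 0) (ctail x))); split.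
- apply: (uniformly_cts_piecewise head_factors
    (k := fun b => ccons b \o (g b \o ctail))) => b.
  have [gc _ _ _ _] := kP b.
  apply: uniformly_cts_comp; first exact: uniformly_cts_cons.
  by apply: uniformly_cts_comp => //; exact: uniformly_cts_tail.
- apply: (uniformly_cts_piecewise head_factors
    (k := fun b => ccons b \o (k b \o ctail))) => b.
  have [_ kc _ _ _] := kP b.
  apply: uniformly_cts_comp; first exact: uniformly_cts_cons.
  by apply: uniformly_cts_comp => //; exact: uniformly_cts_tail.
- by move=> y; have [_ _ + _ _] := kP (y 0); exact.
- move=> y /=; have [_ _ _ kg _] := kP (y 0).
  by rewrite -[RHS]ccons_tail -[in RHS](kg (ctail y)).
- move=> x Px /=; have [_ _ _ _ gk] := kP (x 0).
  rewrite -[RHS]ccons_tail -[in RHS](gk (ctail x))//.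
  by rewrite /Pb ccons_tail.
Qed.

(** Each class of [s] and of [t] is nonempty and clopen, hence a copy of the Cantor space; through
    these copies [f] carries the [s]-class of [e] onto the [t]-class of [e]. *)
Lemma homeo_between_colorings L (E : finType) (s t : cantor_space -> E) :
  factors_through L s -> factors_through L t ->
  (forall e, exists x, s x = e) -> (forall e, exists x, t x = e) ->
  exists f g : cantor_space -> cantor_space,
    [/\ uniformly_cts f, uniformly_cts g, cancel f g, cancel g f
      & forall x, t (f x) = s x].
Proof.
move=> sL tL ssurj tsurj.
have cl (u : cantor_space -> E) : factors_through L u ->
    (forall e, exists x, u x = e) -> forall e,
    exists gk : (cantor_space -> cantor_space) * (cantor_space -> cantor_space),
      [/\ uniformly_cts gk.1, uniformly_cts gk.2, forall y, u (gk.2 y) = e,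
          cancel gk.2 gk.1 & forall x, u x = e -> gk.2 (gk.1 x) = x].
  move=> uL usurj e.
  have [||g [k [gc kc uk kg gk]]] := @clopen_cantor L (fun x => u x == e).
  - by move=> x y /uL ->.
  - by have [x <-] := usurj e; exists x.
  by exists (g, k); split=> //= x; [exact/eqP|move/eqP/gk].
have [p pP] := choice (cl s sL ssurj).
have [q qP] := choice (cl t tL tsurj).
have tf x : t ((q (s x)).2 ((p (s x)).1 x)) = s x by have [_ _ ->] := qP (s x).
have sg x : s ((p (t x)).2 ((q (t x)).1 x)) = t x by have [_ _ ->] := pP (t x).
exists (fun x => (q (s x)).2 ((p (s x)).1 x)),
       (fun x => (p (t x)).2 ((q (t x)).1 x)).
split=> //.
- apply: (uniformly_cts_piecewise sL (k := fun e => (q e).2 \o (p e).1)) => e.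
  by apply: uniformly_cts_comp; [case: (qP e)|case: (pP e)].
- apply: (uniformly_cts_piecewise tL (k := fun e => (p e).2 \o (q e).1)) => e.
  by apply: uniformly_cts_comp; [case: (pP e)|case: (qP e)].
- move=> x; rewrite tf; have [_ _ _ -> _] := qP (s x).
  by have [_ _ _ _ ->] := pP (s x).
- move=> x; rewrite sg; have [_ _ _ -> _] := pP (t x).
  by have [_ _ _ _ ->] := qP (t x).
Qed.

(* The L coordinates that determine c leave the later ones free to encode a
   choice of e in the fibre of src. *)
Lemma lift_coloring L (V E : finType) (src : E -> V) (c : cantor_space -> V) :
  factors_through L c -> (forall v, exists x, c x = v) ->
  (forall v, exists e, src e = v) ->
  exists d : cantor_space -> E,
    [/\ factors_through (L + #|E|) d, forall e, exists x, d x = e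
      & forall x, src (d x) = c x].
Proof.
move=> cL csurj srcsurj; have [sec secK] := choice srcsurj.
(* The first [true] among the [#|E|] coordinates from [L] on selects an element of [enum E]; if
   there is none, [find] runs past the end and the default [sec (c x)] is taken. *)
pose w x := nth (sec (c x)) (enum E) (find (fun i => x (L + i)) (iota 0 #|E|)).
exists (fun x => if src (w x) == c x then w x else sec (c x)); split.
- move=> x y xy; have cxy : c x = c y.
    by apply: cL; apply: agreeW xy; rewrite leq_addr.
  suff -> : w x = w y by rewrite cxy.
  rewrite /w cxy; congr nth; apply: eq_in_find => i.
  by rewrite mem_iota/= add0n => iE; apply: xy; rewrite ltn_add2l.
- move=> e; have [x cx] := csurj (src e).
  pose y : cantor_space :=
    fun n => if (n < L)%N then x n else n == L + index e (enum E).
  have cy : c y = src e by rewrite -cx; apply: cL => i iL; rewrite /y iL.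
  exists y; suff -> : w y = e by rewrite cy eqxx.
  have idx : (index e (enum E) < #|E|)%N by rewrite cardE index_mem mem_enum.
  rewrite /w; suff -> : find (fun i => y (L + i)) (iota 0 #|E|) =
      index e (enum E).
    by rewrite nth_index// mem_enum.
  rewrite (@eq_find _ _ (pred1 (index e (enum E)))); last first.
    by move=> i; rewrite /y ltnNge leq_addr/= eqn_add2l.
  rewrite -[X in find (pred1 X)](nth_iota 0 0 idx).
  by rewrite -/(index _ _) index_uniq ?size_iota ?iota_uniq.
- by move=> x; case: eqP.
Qed.

(** * Walks in finite digraphs *)

(** Pigeonhole on the finitely many self-maps of [Q], which makes [i] and [j] independent of [a]. *)
Lemma iter_collision (Q : finType) (p : Q -> Q) :
  exists i j, (i < j)%N /\ forall a, iter i p a = iter j p a.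
Proof.
pose F (i : 'I_(#|{ffun Q -> Q}|).+1) := [ffun a => iter i p a].
have /injectivePn[i [j ij /ffunP Fij]] : ~~ injectiveb F.
  apply/injectiveP => /leq_card; rewrite card_ord; by rewrite ltnn.
have {}Fij a : iter i p a = iter j p a by have := Fij a; rewrite !ffunE.
have /orP[ij'|ij'] : (i < j)%N || (j < i)%N by rewrite -neq_ltn.
  by exists i, j.
by exists j, i; split.
Qed.

(* Above a, the fibre is the backward walk a, p a, p (p a), ... along chosen
   predecessors, closed up into a cycle at its far end (where p^i = p^j); once a
   path reaches height 0 it follows the chosen successors s.  The only choice
   left is to leave the cycle, which switches rho off for good. *)
Lemma eventually_deterministic_cover (Q : finType) (edge : Q -> Q -> Prop) :
  (forall a, exists b, edge a b) -> (forall b, exists a, edge a b) ->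
  exists (V E : finType) (label : V -> Q) (src tgt : E -> V) (phi : V -> V)
      (rho : V -> bool),
    [/\ forall a, exists v, label v = a,
        (forall v, exists e, src e = v) /\ (forall v, exists e, tgt e = v),
        forall e, edge (label (src e)) (label (tgt e)),
        forall e, rho (tgt e) -> rho (src e) &
        forall e, tgt e <> phi (src e) -> rho (src e) /\ ~~ rho (tgt e)].
Proof.
move=> /choice[s sP] /choice[p pP].
have [i [j [ij pij]]] := iter_collision p.
pose V : finType := (Q * 'I_j.+1)%type.
pose label (v : V) := iter v.2 p v.1.
(* Descending one height follows an edge, from [p b] to [b]. Heights [i.+1] to [j] form the cycle:
   since p^i = p^j, the step down from [i.+1] may land at height [j] instead of [i]. *)
pose phi (v : V) : V :=
  if v.2 == 0 :> nat then (s v.1, ord0)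
  else if v.2 == i.+1 :> nat then (v.1, ord_max) else (v.1, inord v.2.-1).
exists V, (V + Q)%type, label.
(* The edges [inl v] obey [phi]; [inr a] is the exit from the cycle above [a]. *)
exists (fun e => match e with inl v => v | inr a => (a, inord i.+1) end).
exists (fun e => match e with inl v => phi v | inr a => (a, inord i) end).
exists phi, (fun v : V => i < v.2)%N.
have ij1 : (i.+1 < j.+1)%N by [].
have ij0 : (i < j.+1)%N by exact: ltnW.
split.
- by move=> a; exists (a, ord0).
- split; first by move=> v; exists (inl v).
  move=> [a k]; have [kj|kj] := eqVneq (k : nat) j.
    exists (inl (a, inord i.+1)); rewrite /phi/= inordK//= eqxx.
    by congr (_, _); apply: val_inj.
  have [ki|ki] := eqVneq (k : nat) i.
    by exists (inr a); congr (_, _); apply: val_inj; rewrite /= inordK.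
  have kj1 : (k.+1 < j.+1)%N.
    by rewrite ltnS ltn_neqAle kj -ltnS ltn_ord.
  exists (inl (a, inord k.+1)); rewrite /phi/= inordK//= eqSS (negbTE ki).
  by congr (_, _); apply: val_inj; rewrite /= inordK.
- case=> [[a k]|a] /=; last by rewrite /label/= !inordK//=; exact: pP.
  rewrite /phi/=; case: eqP => [k0|k0]; first by rewrite /label/= k0.
  case: eqP => [ki|/eqP ki]; first by rewrite /label/= ki -pij; exact: pP.
  case: k k0 ki => -[|k]//= kj _ ki.
  rewrite /label/= inordK//; last exact: ltnW.
- case=> [[a k]|a] /=; last by rewrite !inordK// ltnn.
  rewrite /phi/=; case: eqP => [k0|k0]//.
  case: eqP => [->|/eqP ki]//.
  case: k k0 ki => -[|k]//= kj _ ki; rewrite inordK//; last exact: ltnW.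
  by move=> ik; exact: ltnW.
- by case=> [v|a]//= _; rewrite !inordK// ltnn.
Qed.

(** * Predictability, its openness and its density *)

(* [rho] certifies that an orbit disobeys [phi] at most once: it can only switch
   from true to false, and does so at every disobedience. *)
Definition predictable (m : nat) (h : cantor_space -> cantor_space) :=
  exists (V : Type) (c : cantor_space -> V) (phi : V -> V) (rho : V -> bool) L,
    [/\ factors_through L c,
        forall x y, c x = c y -> agree m x y,
        forall x, rho (c (h x)) -> rho (c x) &
        forall x, c (h x) <> phi (c x) -> rho (c x) /\ ~~ rho (c (h x))].

Lemma predictable_open m h : predictable m h ->
  exists L, forall f, (forall x, agree L (f x) (h x)) -> predictable m f.
Proof.
move=> [V [c [phi [rho [L [cL cm rho1 rho2]]]]]]; exists L => f fh.
have cfh x : c (f x) = c (h x) by exact: cL.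
by exists V, c, phi, rho, L; split=> // x; rewrite cfh;
  [exact: rho1|exact: rho2].
Qed.

Lemma predictable_dense m n h :
  uniformly_cts h -> (forall y, exists x, h x = y) ->
  exists f g, [/\ uniformly_cts f, uniformly_cts g, cancel f g, cancel g f
    & predictable m f /\ forall x, agree n (f x) (h x)].
Proof.
move=> hc hsurj; have [L0 hL0] := hc n.
(* Long enough for the cell size [m], the precision [n] of the approximation and the modulus [L0] of
   [h]. *)
pose L := (m + n + L0)%N.
have mL : (m <= L)%N by rewrite /L -addnA leq_addr.
have nL : (n <= L)%N by rewrite /L addnAC leq_addl.
have hL x y : agree L x y -> agree n (h x) (h y).
  by move=> xy; apply: hL0; apply: agreeW xy; rewrite leq_addl.
pose Q := {ffun 'I_L -> bool}.
pose c0 (x : cantor_space) : Q := [ffun i : 'I_L => x i].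
have c0P x y : c0 x = c0 y <-> agree L x y.
  split=> [/ffunP xy i iL|xy]; first by have := xy (Ordinal iL); rewrite !ffunE.
  by apply/ffunP => i; rewrite !ffunE; exact: xy.
have c0surj a : exists x, c0 x = a.
  exists (fun k => if insub k is Some i then a i else false).
  by apply/ffunP => i; rewrite ffunE valK.
pose edge a b := exists x, c0 x = a /\ c0 (h x) = b.
have [||V [E [label [src [tgt [phi [rho
    [labs [srcs tgts] edgeP rho1 rho2]]]]]]]] :=
    @eventually_deterministic_cover Q edge.
- by move=> a; have [x <-] := c0surj a; exists (c0 (h x)), x.
- move=> b; have [y <-] := c0surj b; have [x <-] := hsurj y.
  by exists (c0 x), x.
have c0L : factors_through L c0 by move=> x y /c0P.
(* [c] splits each cylinder among the vertices above it; [s] and [t] split each vertex class among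
   its outgoing and its incoming edges. Sending [s]-classes to [t]-classes moves every point along
   an edge. *)
have [c [cL cs lc]] := lift_coloring c0L c0surj labs.
have [s [sL ss srcs_c]] := lift_coloring cL cs srcs.
have [t [tL ts tgts_c]] := lift_coloring cL cs tgts.
have [f [g [fc gc fg gf tf]]] := homeo_between_colorings sL tL ss ts.
have cf x : c (f x) = tgt (s x) by rewrite -tgts_c tf.
exists f, g; split=> //; split.
- exists V, c, phi, rho, (L + #|V|)%N; split=> //.
  + move=> x y cxy; apply: (agreeW mL); apply/c0P.
    by rewrite -!lc cxy.
  + by move=> x; rewrite cf -srcs_c; exact: rho1.
  + by move=> x; rewrite cf -srcs_c; exact: rho2.
(* The edge [s x] comes from a point [z] in the cylinder of [x] whose image [h z] is in the cylinder
   of [f x]. *)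
- move=> x; have [z [zx hzf]] := edgeP (s x).
  rewrite srcs_c lc in zx; rewrite -cf lc in hzf.
  move/c0P: zx => zx; move/c0P: hzf => hzf.
  apply: (@agree_trans _ (h z)); last exact: hL.
  by apply: agree_sym; exact: agreeW hzf.
Qed.

(** * From prefixes to the metrics, and nowhere density *)

Lemma invS_le_eps (R : realType) (e : R) :
  (0 < e)%R -> exists n, (n.+1%:R^-1 <= e)%R.
Proof.
move=> e0; exists (Num.truncn e^-1)%R.
by rewrite -[leRHS]invrK lef_pV2 ?posrE ?invr_gt0// ltW// truncnS_gt.
Qed.

Lemma cantor_dist_agree (R : realType) n x y :
  (cantor_dist R x y < n.+1%:R^-1)%R <-> agree n.+1 x y.
Proof. exact: cantor_dist_ltP. Qed.

Lemma nbhs_cylinder (R : realType) (x : cantor_space) (A : set cantor_space) :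
  nbhs x A <-> exists n, forall y, agree n x y -> A y.
Proof.
rewrite (@nbhs_ballP R cantor_space); split=> [[e /= e0 eA]|[n nA]].
  have [n ne] := invS_le_eps e0; exists n.+1 => y xy; apply: eA.
  by apply: lt_le_trans ne; apply/cantor_dist_agree.
exists n.+1%:R^-1%R => /=; first by rewrite invr_gt0.
by move=> y /cantor_dist_agree xy; apply: nA; exact: (agreeW (leqnSn n)).
Qed.

Lemma uniformly_ctsP (R : realType) (f : cantor_space -> cantor_space) :
  uniformly_cts f <-> continuous f.
Proof.
split=> [fc x A /(nbhs_cylinder R)[n nA]|fc n].
  apply/(nbhs_cylinder R); have [m mn] := fc n.
  by exists m => y /mn/nA.
(* Compactness turns the prefix lengths found at single points into a common one. *)
have cK := cantor_space_compact.
move/compact_near_coveringP : cK => /(_ nat \oo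
  (fun m x => forall y, agree m x y -> agree n (f x) (f y)) _) [].
  move=> x _.
  have : nbhs (f x) [set y | agree n (f x) y].
    by apply/(nbhs_cylinder R); exists n.
  move=> /fc /(nbhs_cylinder R)[m mf].
  exists ([set y | agree m x y], [set k | (m <= k)%N]) => /=.
    by split; [apply/(nbhs_cylinder R); exists m|exists m].
  move=> [x' k] /= [xx' mk] y x'y.
  apply: (@agree_trans _ (f x)); first by apply: agree_sym; exact: mf.
  by apply: mf; apply: (agree_trans xx'); exact: agreeW x'y.
by move=> m _ mP; exists m => x y; apply: mP => //=.
Qed.

Lemma homeo_dist_agree (R : realType) n (f h : cantor_homeo R) :
  (homeo_dist f h < n.+1%:R^-1)%R <-> forall x, agree n.+1 (f x) (h x).
Proof.
split=> [fh x|fh]; last first.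
  by have [x ->] := homeo_dist_max f h; exact/cantor_dist_agree.
by apply/(cantor_dist_agree R); exact: le_lt_trans (homeo_dist_ub f h x) fh.
Qed.

Lemma homeo_ballE (R : realType) (h : cantor_homeo R) e :
  ball h e = [set f | (homeo_dist h f < e)%R].
Proof. by rewrite ballEmdist. Qed.

(** Every ball contains a predictable homeomorphism, around which a whole ball is predictable. *)
Lemma not_predictable_nowhere_dense (R : realType) m :
  nowhere_dense [set h : cantor_homeo R | ~ predictable m h].
Proof.
rewrite /nowhere_dense -subset0 => h.
move=> /(@nbhs_ballP R (cantor_homeo R))[e /= e0 eh].
have [n ne] := invS_le_eps e0.
have [h' [hh' h'h hc h'c]] := homeo_funP h.
have hsurj y : exists x, h x = y by exists (h' y).
have [f [g [fc gc fg gf [fpred fh]]]] :=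
  predictable_dense m n.+1 ((uniformly_ctsP R h).2 hc) hsurj.
have fP : is_homeomorphism f by exists g; split=> //; exact/(uniformly_ctsP R).
pose F := CantorHomeo R fP.
have : closure [set h : cantor_homeo R | ~ predictable m h] F.
  apply: eh; rewrite homeo_ballE/=.
  apply: lt_le_trans ne; apply/homeo_dist_agree => x.
  by apply: agree_sym; exact: fh.
have [L Lpred] := predictable_open fpred.
move=> /(_ (ball F (L.+1%:R^-1)%R)) [|k [/= nk]].
  by apply: (@nbhsx_ballx R (cantor_homeo R)); rewrite invr_gt0.
rewrite homeo_ballE/= => /homeo_dist_agree Fk.
apply: nk; apply: Lpred => x; apply: agree_sym.
by apply: (agreeW (leqnSn L)); exact: Fk.
Qed.

Local Open Scope ring_scope.

(** * The Prohorov distance and iterates of the induced map *)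

Section Metric.
Context {R : realType} {M : pmetricType R}.
Implicit Types (X : set M) (mu nu : borel_prob M) (d e : R).

Lemma open_borel X : open X -> measurable (X : set (borel M)).
Proof. by move=> oX; exact: sub_sigma_algebra. Qed.

Lemma thickeningP X d x :
  thickening X d x <-> exists2 y, X y & mdist x y < d.
Proof.
split=> [/ereal_inf_ltP[_ [y Xy <-]]|[y Xy xy]].
  by rewrite lte_fin; exists y.
by apply/ereal_inf_ltP; exists (mdist x y)%:E; [exists y|rewrite lte_fin].
Qed.

Lemma thickening_measurable X d : measurable (thickening X d : set (borel M)).
Proof.
apply: open_borel; rewrite openE => x /thickeningP[y Xy xy].
apply/(@nbhs_ballP R M); exists (d - mdist x y) => /=.
  by rewrite subr_gt0.
move=> z; rewrite ballEmdist/= ltrBrDr => xz; apply/thickeningP; exists y => //.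
by apply: le_lt_trans (metric_triangle z x y) _; rewrite metric_sym.
Qed.

Definition prohorov_close mu nu d := forall X : set (borel M), measurable X ->
  (mu X <= nu (thickening X d) + d%:E /\ nu X <= mu (thickening X d) + d%:E)%E.

Lemma prohorov_dist_le mu nu d :
  0 < d -> prohorov_close mu nu d -> prohorov_dist mu nu <= d.
Proof.
by move=> d0 mnd; apply: ge_inf => //; exists 0 => e [/ltW].
Qed.

Lemma prohorov_dist_lt mu nu e : prohorov_dist mu nu < e ->
  exists2 d, 0 < d < e & prohorov_close mu nu d.
Proof.
move=> /inf_lt[|d [d0 mnd] de]; last by exists d; rewrite ?d0.
(* The infimum is over a nonempty set: 1 qualifies because probabilities are at most 1. *)
exists 1; split=> // X mX; split.
  by rewrite (le_trans (probability_le1 mu mX))// leeDr// measure_ge0.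
by rewrite (le_trans (probability_le1 nu mX))// leeDr// measure_ge0.
Qed.

Lemma iter_induced_map (f : continuousType M M) mu n (X : set (borel M)) :
  iter n (induced_map f) mu X = mu (iter n f @^-1` X).
Proof.
elim: n X => [|n IH] X//=.
by rewrite -[LHS]/(iter n (induced_map f) mu (f @^-1` X)) IH.
Qed.

End Metric.

(** * Tails of sequences, lower and upper limits *)

(** Once [u] is within [e] of its infimum, it can drop by at most [e]. *)
Lemma nonincreasing_tail (R : realType) (u : nat -> R) (e : R) :
  (forall n, 0 <= u n) -> (forall n k, u (k + n)%N <= u n) -> 0 < e ->
  exists n0, forall n k, (n0 <= n)%N -> u n - u (k + n)%N <= e.
Proof.
move=> u0 umono e0; have lb : has_lbound (range u) by exists 0 => _ [n _ <-].
have [|_ [n0 _ <-] n0e] := @inf_adherent R (range u) e e0.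
  by split=> //; exists (u 0%N), 0%N.
exists n0 => n k n0n.
have un : u n <= u n0 by rewrite -(subnK n0n).
have uk : inf (range u) <= u (k + n)%N by apply: ge_inf => //; exists (k + n)%N.
lra.
Qed.

Lemma limn_einf_lt (R : realType) (u : nat -> \bar R) (x : \bar R) n0 :
  (limn_einf u < x)%E -> exists2 n, (n0 <= n)%N & (u n < x)%E.
Proof.
rewrite -[limn_einf u]/(limf_einf u \oo) limf_einfE => ux.
have : (ereal_inf (u @` [set n | (n0 <= n)%N]) < x)%E.
  apply: le_lt_trans ux; apply: ereal_sup_ubound.
  by exists [set n | (n0 <= n)%N] => //; exists n0.
by move=> /ereal_inf_ltP[_ [n n0n <-] nx]; exists n.
Qed.

Lemma limn_esup_le (R : realType) (u : nat -> \bar R) (x : \bar R) n0 :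
  (forall n, (n0 <= n)%N -> (u n <= x)%E) -> (limn_esup u <= x)%E.
Proof.
move=> ux; apply: ge_ereal_inf.
exists (ereal_sup (u @` [set n | (n0 <= n)%N])).
  by exists [set n | (n0 <= n)%N] => //; exists n0.
by apply: ge_ereal_sup => _ [n /= n0n <-]; exact: ux.
Qed.

(** * Itineraries of points and real-valued masses *)

Section Itinerary.
Variables (V : Type) (h : cantor_space -> cantor_space) (c : cantor_space -> V).
Variables (phi : V -> V) (rho : V -> bool).
Hypothesis rho_mono : forall x, rho (c (h x)) -> rho (c x).
Hypothesis rho_escape :
  forall x, c (h x) <> phi (c x) -> rho (c x) /\ ~~ rho (c (h x)).

Lemma iter_rho_mono k x : rho (c (iter k h x)) -> rho (c x).
Proof. by elim: k => //= k IH /rho_mono. Qed.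

(** Disobeying [phi] before time [k] needs [rho] true just before and false just after; by
    monotonicity it is then true at time 0 and false at time [k]. *)
Lemma iter_itinerary k x : ~ (rho (c x) /\ ~~ rho (c (iter k h x))) ->
  c (iter k h x) = iter k phi (c x).
Proof.
move=> nesc; have {nesc} : rho (c (iter k h x)) || ~~ rho (c x).
  by apply/negPn/negP; rewrite negb_or negbK => /andP[? ?]; apply: nesc.
elim: k => // k IH /= esc.
have {}IH : c (iter k h x) = iter k phi (c x).
  by apply: IH; case/orP: esc => [/rho_mono ->//|->]; rewrite orbT.
apply: contrapT; rewrite -IH => /rho_escape[rk nrk].
case/orP: esc => [|/negP]; first by rewrite (negbTE nrk).
by apply; exact: iter_rho_mono rk.
Qed.

End Itinerary.

Section FineMeasure.
Context d (T : measurableType d) (R : realType) (mu : probability T R).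
Implicit Types A B C : set T.

Lemma fine_measure_setU A B C : measurable A -> measurable B -> measurable C ->
  A `<=` B `|` C -> fine (mu A) <= fine (mu B) + fine (mu C).
Proof.
move=> mA mB mC ABC; rewrite -fineD ?fin_num_measure//.
apply: fine_le; rewrite ?fin_numD ?fin_num_measure//.
rewrite (le_trans _ (measureU2 _ mB mC))// le_measure ?inE//.
exact: measurableU.
Qed.

Lemma fine_measureD A B : measurable A -> measurable B ->
  B `<=` A -> fine (mu (A `\` B)) = fine (mu A) - fine (mu B).
Proof.
move=> mA mB BA; rewrite measureD//; last first.
  by rewrite ltey_eq fin_num_measure.
by rewrite (setIidr BA) fineB ?fin_num_measure.
Qed.

End FineMeasure.

(** * Measures under a predictable homeomorphism *)

Local Notation cantor_prob R := (borel_prob (cantor_space : pmetricType R)).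
Local Notation cantor_borel_set R :=
  (set (borel (cantor_space : pmetricType R))).
Local Notation induced h := (induced_map (M := cantor_space) h).

Lemma coloring_measurable (R : realType) L V (c : cantor_space -> V)
    (S : set V) :
  factors_through L c ->
  measurable (c @^-1` S : cantor_borel_set R).
Proof.
move=> cL; apply: (@open_borel R cantor_space); rewrite openE => x Sx.
by apply/(nbhs_cylinder R); exists L => y /cL cxy; rewrite /preimage/= -cxy.
Qed.

Lemma uniformly_cts_iter f n : uniformly_cts f -> uniformly_cts (iter n f).
Proof.
move=> fc; elim: n => [|n IH]; first exact: uniformly_cts_id.
exact: uniformly_cts_comp fc IH.
Qed.

Lemma predictable_no_li_yorke (R : realType) (h : cantor_homeo R) :
  (forall m, predictable m h) ->
  ~ has_li_yorke_pair (@prohorov_dist R cantor_space)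
      (induced h).
Proof.
move=> hpred [mu [nu [liminf0]]]; apply/negP; rewrite -leNgt.
pose mun n := iter n (induced h) mu.
pose nun n := iter n (induced h) nu.
apply/lee_addgt0Pr => e e0; rewrite add0e.
(* Points of equal colour will agree on [N.+1] coordinates, hence lie at distance less than [e]. *)
have [N Ne] := invS_le_eps e0.
have [V [c [phi [rho [L [cL cN rho1 rho2]]]]]] := hpred N.+1.
have hc : uniformly_cts h.
  by have [? [_ _ + _]] := homeo_funP h; move/(uniformly_ctsP R).
pose P (S : set V) : cantor_borel_set R := c @^-1` S.
pose Q k S : cantor_borel_set R := iter k h @^-1` P S.
have mP S : measurable (P S) by exact: coloring_measurable cL.
have mQ k S : measurable (Q k S).
  have [L' hL'] := uniformly_cts_iter k hc L.
  by apply: (@coloring_measurable R L' V (c \o iter k h)) => x y /hL'/cL.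
have QE (lam : cantor_prob R) n k S :
    iter (k + n) (induced h) lam (P S) =
    iter n (induced h) lam (Q k S).
  by rewrite iterD iter_induced_map.
have Qmono k : Q k rho `<=` P rho by move=> x; exact: iter_rho_mono rho1 k x.
(* The mass where [rho] holds never grows, so after some time at most [e / 3] of it can still switch
   off. *)
have tail (lam : cantor_prob R) : exists n0, forall n k, (n0 <= n)%N ->
    fine (iter n (induced h) lam (P rho)) -
    fine (iter n (induced h) lam (Q k rho)) <= e / 3.
  have [|||n0 n0P] := @nonincreasing_tail R
    (fun n => fine (iter n (induced h) lam (P rho))) (e / 3).
  - by move=> n; exact: fine_ge0.
  - move=> n k; rewrite QE; apply: fine_le; rewrite ?fin_num_measure//.
    by rewrite le_measure ?inE.
  - by rewrite divr_gt0.
  by exists n0 => n k n0n; rewrite -QE; exact: n0P.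
(* The two sets can differ only at points where [rho] switches off within [k] steps. *)
have step (lam : cantor_prob R) k S :
    fine (lam (Q k S)) <= fine (lam (P (iter k phi @^-1` S))) +
       (fine (lam (P rho)) - fine (lam (Q k rho))) /\
    fine (lam (P (iter k phi @^-1` S))) <= fine (lam (Q k S)) +
       (fine (lam (P rho)) - fine (lam (Q k rho))).
  have mD : measurable (P rho `\` Q k rho) by exact: measurableD.
  rewrite -fine_measureD//; split; apply: fine_measure_setU => // x Sx.
    have [[? /negP ?]|/(iter_itinerary rho1 rho2) kx] :=
        pselect (rho (c x) /\ ~~ rho (c (iter k h x))).
      by right.
    by left; rewrite /P/preimage/= -kx.
  have [[? /negP ?]|/(iter_itinerary rho1 rho2) kx] :=
        pselect (rho (c x) /\ ~~ rho (c (iter k h x))).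
    by right.
  by left; rewrite /Q/P/preimage/= kx.
have [n1 n1P] := tail mu; have [n2 n2P] := tail nu.
have thickP S (d : R) :
    d <= L.+1%:R^-1 -> thickening (M := cantor_space) (P S) d `<=` P S.
  move=> dL x /thickeningP[y Sy xy]; rewrite /P/preimage/= (cL x y)//.
  apply: (agreeW (leqnSn L)); apply/(cantor_dist_agree R).
  exact: lt_le_trans xy dL.
(* Below [L.+1%:R^-1], thickening a union of colour classes adds nothing, so Prohorov closeness
   compares the masses of the classes directly. *)
pose d0 : R := Num.min (e / 3) L.+1%:R^-1.
have d00 : 0 < d0 by rewrite lt_min divr_gt0//= invr_gt0.
have [n n12 nd0] : exists2 n, (maxn n1 n2 <= n)%N &
    ((prohorov_dist (mun n) (nun n))%:E < d0%:E)%E.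
  by apply: limn_einf_lt; rewrite liminf0 lte_fin.
move: nd0; rewrite lte_fin => /prohorov_dist_lt[d /andP[d_gt0 dd0] munu].
move: dd0; rewrite lt_min => /andP[de dL].
have {munu} close S : fine (mun n (P S)) <= fine (nun n (P S)) + e / 3 /\
    fine (nun n (P S)) <= fine (mun n (P S)) + e / 3.
  have le_thick (a b : cantor_prob R) :
    (a (P S) <= b (thickening (M := cantor_space) (P S) d) + d%:E)%E ->
    fine (a (P S)) <= fine (b (P S)) + e / 3.
    move=> ab; have : (a (P S) <= b (P S) + (e / 3)%:E)%E.
      apply: (le_trans ab); apply: leeD; last by rewrite lee_fin ltW.
      rewrite le_measure ?inE//.
        exact: (@thickening_measurable R cantor_space).
      by apply: thickP; exact: ltW.
    rewrite -[X in (X <= _)%E]fineK ?fin_num_measure//.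
    by rewrite -[X in (_ <= X + _)%E]fineK ?fin_num_measure.
  by have [] := munu (P S) (mP S); split; exact: le_thick.
(* Three errors of [e / 3]: the escaping mass of each measure, and their difference at time [n]. *)
have {}close k S :
    fine (mun (k + n)%N (P S)) <= fine (nun (k + n)%N (P S)) + e /\
    fine (nun (k + n)%N (P S)) <= fine (mun (k + n)%N (P S)) + e.
  rewrite /mun /nun !QE -/(mun n) -/(nun n).
  have [m1 m2] := step (mun n) k S; have [v1 v2] := step (nun n) k S.
  have [c1 c2] := close (iter k phi @^-1` S).
  have t1 := n1P n k (leq_trans (leq_maxl _ _) n12).
  have t2 := n2P n k (leq_trans (leq_maxr _ _) n12).
  rewrite -/(mun n) in t1; rewrite -/(nun n) in t2.
  by split; lra.
apply: (@limn_esup_le _ _ _ n) => m nm; rewrite lee_fin -(subnK nm).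
set k := (m - n)%N; apply: prohorov_dist_le => // X mX.
(* Saturating [X] by colour classes puts [P S] between [X] and its [e]-thickening. *)
pose S := c @` X.
have XS : X `<=` P S by move=> x Xx; exists x.
have SX : P S `<=` thickening (M := cantor_space) X e.
  move=> x [y Xy cyx]; apply/thickeningP; exists y => //.
  apply: lt_le_trans Ne; apply/(cantor_dist_agree R); exact: cN.
have le_thick (a b : cantor_prob R) :
    fine (a (P S)) <= fine (b (P S)) + e ->
    (a X <= b (thickening (M := cantor_space) X e) + e%:E)%E.
  move=> ab; apply: (@le_trans _ _ (a (P S))); first by rewrite le_measure ?inE.
  apply: (@le_trans _ _ (b (P S) + e%:E)%E).
    rewrite -[X in (X <= _)%E]fineK ?fin_num_measure//.
    by rewrite -[X in (_ <= X + _)%E]fineK ?fin_num_measure.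
  apply: leeD => //; rewrite le_measure ?inE//.
  exact: (@thickening_measurable R cantor_space).
by have [] := close k S; split; exact: le_thick.
Qed.

Theorem theorem1 (R : realType) :
  meager [set h : cantor_homeo R |
    has_li_yorke_pair (@prohorov_dist R cantor_space)
                      (induced_map (M := cantor_space) h)].
Proof.
pose LY := [set h : cantor_homeo R | has_li_yorke_pair
  (@prohorov_dist R cantor_space) (induced_map (M := cantor_space) h)].
(* The intersection with [LY] is taken because [meager] asks for equality with the union. *)
exists (fun m => LY `&` [set h | ~ predictable m h]).
  move=> m; apply/seteqP; split=> // h hcl.
  rewrite -[set0](@not_predictable_nowhere_dense R m).
  by apply: interiorS hcl; apply: closureS => f [].
rewrite -setI_bigcupr; apply/seteqP; split=> [h LYh|h []//]; split=> //.
apply: contrapT => hpred; apply: (@predictable_no_li_yorke R h) => // m.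
by apply: contrapT => nm; apply: hpred; exists m.
Qed.
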